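(* As formal power series in $z$, $$\mathfrak I(q,t,x;z)=\cfrac{1}{1-txz-\cfrac{tq\,z^2}{1-(1+t)q\,z-\cfrac{tq^3z^2}{1-(1+t)q^2z-\cfrac{tq^5z^2}{1-(1+t)q^3z-\cdots}}}},$$ i.e. the Jacobi-type continued fraction with $b_0=tx$, $b_j=(1+t)q^j$ and $\lambda_j=tq^{2j-1}$ for $j\ge1$.
   Context: $\mathrm{Av}_n(321)$ is the set of permutations $\sigma=a_1\ldots a_n$ of $[n]$ with no $i<j<k$ such that $a_i>a_j>a_k$ (for $n=0$, only the empty permutation). $\mathrm{inv}\,\sigma=\#\{(i,j):i<j,\ a_i>a_j\}$; $\mathrm{lrm}\,\sigma$ is the number of $i$ with $a_i=\max\{a_1,\dots,a_i\}$; $\mathrm{fix}\,\sigma=\#\{i:a_i=i\}$. Let $I_n(q,t,x)=\sum_{\sigma\in\mathrm{Av}_n(321)}q^{\mathrm{inv}\,\sigma}t^{\mathrm{lrm}\,\sigma}x^{\mathrm{fix}\,\sigma}$ and $\mathfrak I(q,t,x;z)=\sum_{n\ge0}I_n(q,t,x)z^n$. A Jacobi-type continued fraction $\cfrac{1}{1-b_0z-\cfrac{\lambda_1z^2}{1-b_1z-\cfrac{\lambda_2z^2}{1-b_2z-\cdots}}}$ is understood as the $z$-adic limit of its finite truncations in the ring of formal power series in $z$. *)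

(* Defs.v *)
From HB Require Import structures.
From mathcomp Require Import all_boot all_order all_algebra perm.
From mathcomp Require boolp.
From mathcomp Require Import mpoly.

Set Implicit Arguments.
Unset Strict Implicit.
Unset Printing Implicit Defensive.

Import GRing.Theory.

Local Open Scope ring_scope.

(* The ring R[[z]] of formal power series in one variable, with the Cauchy
   product; [fcoef f n] is the coefficient of z^n in f. *)
Record fps (R : Type) := Fps { fcoef : nat -> R }.

HB.instance Definition _ (R : Type) := boolp.gen_eqMixin (fps R).
HB.instance Definition _ (R : Type) := boolp.gen_choiceMixin (fps R).

Lemma fpsP (R : Type) (f g : fps R) : fcoef f =1 fcoef g <-> f = g.
Proof.
split=> [|->] //; case: f => f; case: g => g /= fg; congr Fps.
exact: boolp.funext.
Qed.

Section Zmodule.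
Variable R : zmodType.
Implicit Types f g h : fps R.

Definition fps_zero : fps R := Fps (fun=> 0).
Definition fps_opp f : fps R := Fps (fun n => - fcoef f n).
Definition fps_add f g : fps R := Fps (fun n => fcoef f n + fcoef g n).

Fact fps_addA : associative fps_add.
Proof. by move=> f g h; apply/fpsP=> n /=; rewrite addrA. Qed.
Fact fps_addC : commutative fps_add.
Proof. by move=> f g; apply/fpsP=> n /=; rewrite addrC. Qed.
Fact fps_add0 : left_id fps_zero fps_add.
Proof. by move=> f; apply/fpsP=> n /=; rewrite add0r. Qed.
Fact fps_addN : left_inverse fps_zero fps_opp fps_add.
Proof. by move=> f; apply/fpsP=> n /=; rewrite addNr. Qed.

HB.instance Definition _ := GRing.isZmodule.Build (fps R)
  fps_addA fps_addC fps_add0 fps_addN.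

Lemma fcoef0 n : fcoef (0 : fps R) n = 0. Proof. by []. Qed.
Lemma fcoefN f n : fcoef (- f) n = - fcoef f n. Proof. by []. Qed.
Lemma fcoefD f g n : fcoef (f + g) n = fcoef f n + fcoef g n.
Proof. by []. Qed.
Lemma fcoefB f g n : fcoef (f - g) n = fcoef f n - fcoef g n.
Proof. by []. Qed.
End Zmodule.

Section Ring.
Variable R : comNzRingType.
Implicit Types (f g h : fps R) (c : R).

Definition fps_const c : fps R := Fps (fun n => if n == 0%N then c else 0).
Definition fps_mul f g : fps R :=
  Fps (fun n => \sum_(i < n.+1) fcoef f i * fcoef g (n - i)%N).

Let trunc n f := \poly_(i < n.+1) fcoef f i.

Let coef_trunc n f i : (i <= n)%N -> (trunc n f)`_i = fcoef f i.
Proof. by move=> le_in; rewrite coef_poly ltnS le_in. Qed.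

Let fps_mul_trunc f g m n : (m <= n)%N ->
  fcoef (fps_mul f g) m = (trunc n f * trunc n g)`_m.
Proof.
move=> le_mn; rewrite coefM; apply: eq_bigr => -[i /=]; rewrite ltnS => le_im _.
rewrite !coef_trunc ?(leq_trans le_im) //.
exact: leq_trans (leq_subr _ _) le_mn.
Qed.

Fact fps_mulC : commutative fps_mul.
Proof.
by move=> f g; apply/fpsP=> n; rewrite !(@fps_mul_trunc _ _ _ n) // mulrC.
Qed.
Fact fps_mulA : associative fps_mul.
Proof.
move=> f g h; apply/fpsP=> n.
transitivity (trunc n f * trunc n g * trunc n h)`_n.
  rewrite -mulrA coefM; apply: eq_bigr => -[i /=]; rewrite ltnS => le_in _.
  by rewrite -fps_mul_trunc ?leq_subr // coef_trunc.
rewrite coefM; apply: eq_bigr => -[i /=]; rewrite ltnS => le_in _.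
by rewrite -fps_mul_trunc // coef_trunc ?leq_subr.
Qed.
Fact fps_mul1 : left_id (fps_const 1) fps_mul.
Proof.
move=> f; apply/fpsP=> n /=; rewrite big_ord_recl /= mul1r subn0.
by rewrite big1 ?addr0 // => i _; rewrite mul0r.
Qed.
Fact fps_mulDl : left_distributive fps_mul +%R.
Proof.
move=> f g h; apply/fpsP=> n /=; rewrite -big_split /=.
by apply: eq_bigr => i _; rewrite mulrDl.
Qed.
Fact fps_1_neq0 : fps_const 1 != 0.
Proof.
by apply/eqP=> /fpsP/(_ 0%N)/= /eqP; rewrite (negbTE (oner_neq0 R)).
Qed.

HB.instance Definition _ := GRing.Zmodule_isComNzRing.Build (fps R)
  fps_mulA fps_mulC fps_mul1 fps_mulDl fps_1_neq0.

(* The variable z. *)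
Definition fps_X : fps R := Fps (fun n => if n == 1%N then 1 else 0).

Lemma fcoefC c n : fcoef (fps_const c) n = if n == 0%N then c else 0.
Proof. by []. Qed.
Lemma fcoef1 n : fcoef (1 : fps R) n = if n == 0%N then 1 else 0.
Proof. by []. Qed.
Lemma fcoefX n : fcoef fps_X n = if n == 1%N then 1 else 0.
Proof. by []. Qed.
Lemma fcoefM f g n :
  fcoef (f * g) n = \sum_(i < n.+1) fcoef f i * fcoef g (n - i)%N.
Proof. by []. Qed.
Lemma fcoefM0 f g : fcoef (f * g) 0 = fcoef f 0 * fcoef g 0.
Proof. by rewrite fcoefM big_ord1. Qed.
End Ring.

Section UnitRing.
Variable R : comUnitRingType.
Implicit Types f g : fps R.

Definition fps_unit : pred (fps R) := fun f => fcoef f 0 \is a GRing.unit.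

(* The list of the coefficients of z^0, ..., z^n in 1/f. *)
Fixpoint fps_inv_seq f n : seq R :=
  if n is m.+1 then
    let s := fps_inv_seq f m in
    rcons s (- (fcoef f 0)^-1 * \sum_(i < n) s`_i * fcoef f (n - i)%N)
  else [:: (fcoef f 0)^-1].

Definition fps_inv f : fps R :=
  if fps_unit f then Fps (fun n => (fps_inv_seq f n)`_n) else f.

Let size_inv_seq f n : size (fps_inv_seq f n) = n.+1.
Proof. by elim: n => //= n IHn; rewrite size_rcons IHn. Qed.

Let nth_inv_seq f n i : (i <= n)%N ->
  (fps_inv_seq f n)`_i = (fps_inv_seq f i)`_i.
Proof.
elim: n => [|n IHn]; first by rewrite leqn0 => /eqP ->.
rewrite leq_eqVlt => /orP[/eqP -> //|]; rewrite ltnS => le_in.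
by rewrite -IHn //= nth_rcons size_inv_seq ltnS le_in.
Qed.

Fact fps_mulVf : {in fps_unit, left_inverse 1 fps_inv *%R}.
Proof.
move=> f Uf; have Uf0 : fcoef f 0 \is a GRing.unit by [].
apply/fpsP => n; rewrite /fps_inv /fps_unit Uf0.
rewrite fcoefM fcoef1; case: n => [|n]; first by rewrite big_ord1 /= mulVr.
rewrite big_ord_recr /= nth_rcons size_inv_seq ltnn eqxx subnn.
rewrite [_ * fcoef f 0]mulrC mulrA mulrN mulrV // mulN1r; apply/eqP.
rewrite subr_eq0; apply/eqP.
apply: eq_bigr => -[i /=]; rewrite ltnS => le_in _.
by rewrite [in RHS]nth_inv_seq.
Qed.
Fact fps_unitP f g : g * f = 1 -> fps_unit f.
Proof.
move=> /fpsP/(_ 0%N); rewrite fcoefM0 => gf1.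
by apply/unitrPr; exists (fcoef g 0); rewrite mulrC.
Qed.
Fact fps_inv_out : {in [predC fps_unit], fps_inv =1 id}.
Proof. by move=> f /negbTE nUf; rewrite /fps_inv -[fps_unit f]/(f \in fps_unit) nUf. Qed.

HB.instance Definition _ := GRing.ComNzRing_hasMulInverse.Build (fps R)
  fps_mulVf fps_unitP fps_inv_out.

Lemma fps_unitE f : (f \is a GRing.unit) = (fcoef f 0 \is a GRing.unit).
Proof. by []. Qed.
End UnitRing.

(* The sequence u of series tends to l in the z-adic topology. *)
Definition zadic_cvg (R : Type) (u : nat -> fps R) (l : fps R) : Prop :=
  forall m, exists N0, forall N, (N0 <= N)%N ->
    forall k, (k < m)%N -> fcoef (u N) k = fcoef l k.

Lemma zadic_cvg_unique (R : Type) (u : nat -> fps R) (l l' : fps R) :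
  zadic_cvg u l -> zadic_cvg u l' -> l = l'.
Proof.
move=> ul ul'; apply/fpsP => n.
have [N1 H1] := ul n.+1; have [N2 H2] := ul' n.+1.
by rewrite -(H1 (maxn N1 N2)) ?leq_maxl // H2 ?leq_maxr.
Qed.

Section JFraction.
Variable R : comUnitRingType.

(* [jfrac_from b lam N j] is the finite continued fraction
     1 / (1 - b_j z - lam_(j+1) z^2 / ( ... / (1 - b_(j+N) z))). *)
Fixpoint jfrac_from (b lam : nat -> R) (N j : nat) : fps R :=
  let z := fps_X R in
  if N is N'.+1 then
    1 / (1 - fps_const (b j) * z
           - fps_const (lam j.+1) * z ^+ 2 * jfrac_from b lam N' j.+1)
  else 1 / (1 - fps_const (b j) * z).

Definition jfrac_trunc (b lam : nat -> R) (N : nat) : fps R :=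
  jfrac_from b lam N 0.

(* Each truncation is a genuine quotient: all the denominators are units. *)
Lemma jfrac_den0_unit (c : R) :
  1 - fps_const c * fps_X R \is a GRing.unit.
Proof. by rewrite fps_unitE fcoefB fcoefM0 fcoef1 fcoefX mulr0 subr0 unitr1. Qed.

Lemma jfrac_den_unit (c d : R) (f : fps R) :
  1 - fps_const c * fps_X R - fps_const d * fps_X R ^+ 2 * f
    \is a GRing.unit.
Proof.
rewrite fps_unitE !fcoefB expr2 !fcoefM0 fcoef1 !fcoefX.
by rewrite !mulr0 mul0r !subr0 unitr1.
Qed.

Definition is_jfraction (b lam : nat -> R) (f : fps R) : Prop :=
  zadic_cvg (jfrac_trunc b lam) f.
End JFraction.

(* A permutation of [n] is an element of 'S_n acting on {0, ..., n-1}; shifting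
   positions and values by one changes none of the notions below. *)
Section Statistics.
Variable n : nat.
Implicit Type s : 'S_n.

Definition av321 s : bool :=
  ~~ [exists i : 'I_n, exists j : 'I_n, exists k : 'I_n,
        [&& (i < j)%N, (j < k)%N, (s j < s i)%N & (s k < s j)%N]].

Definition inv s : nat :=
  #|[set p : 'I_n * 'I_n | (p.1 < p.2)%N && (s p.2 < s p.1)%N]|.

Definition lrm s : nat :=
  #|[set i : 'I_n | (s i : nat) == (\max_(j < n | (j <= i)%N) s j)%N]|.

Definition fix_ s : nat := #|[set i : 'I_n | s i == i]|.
End Statistics.

Notation Zqtx := {mpoly int[3]}.
Definition q_ : Zqtx := 'X_(0 : 'I_3).
Definition t_ : Zqtx := 'X_(1 : 'I_3).
Definition x_ : Zqtx := 'X_(2 : 'I_3).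

Definition I_poly (n : nat) : Zqtx :=
  \sum_(s : 'S_n | av321 s) q_ ^+ inv s * t_ ^+ lrm s * x_ ^+ fix_ s.

Definition I_series : fps Zqtx := Fps I_poly.

(* Main.v *)
Require Import Defs.
From HB Require Import structures.
From mathcomp Require Import all_boot all_order all_algebra perm.
From mathcomp Require Import mpoly.
From mathcomp Require Import zify ring.

Import GRing.Theory.

Local Open Scope ring_scope.

Set Implicit Arguments.
Unset Strict Implicit.

(* Read a 321-avoiding permutation s through the upper left k x k corners of its
   permutation matrix: the number h of rows of the corner that are empty is also
   the number of its empty columns, and k |-> h is a Motzkin path. Collapsing
   what has been read leaves a 321-avoiding permutation whose first h positions
   carry values >= h. Let W(n,h) be the generating function of such permutations
   with n further rows to read. By 321-avoidance, for h > 0 the next row and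
   column are in one of four situations, according to whether s(0) = h and
   whether s(h) = 0; deleting these entries gives
     W(n+1,h) = W(n,h+1) + (1+t) q^h W(n,h) + t q^(2h-1) W(n,h-1),
   while W(n+1,0) = W(n,1) + t x W(n,0). These are the recurrences satisfied by
   the weighted Motzkin paths from height h to height 0 which the continued
   fraction enumerates. *)

(** * Deleting an entry of a permutation *)

Lemma lift_perm_surj n (i j : 'I_n.+1) (s : 'S_n.+1) :
  s i = j -> exists u : 'S_n, s = lift_perm i j u.
Proof.
(* The default is never taken: s (lift i k) = j would force lift i k = i. *)
move=> sij; pose f k := odflt k (unlift j (s (lift i k))).
have fE k : lift j (f k) = s (lift i k).
  rewrite /f; case: unliftP => [l -> //|].
  by rewrite -sij => /perm_inj/eqP; rewrite eq_sym (negPf (neq_lift i k)).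
have f_inj : injective f.
  by move=> k l /(congr1 (lift j)); rewrite !fE => /perm_inj/lift_inj.
exists (perm f_inj); apply/permP => k.
by case: (unliftP i k) => [k'|] ->; rewrite ?lift_perm_id //
   lift_perm_lift permE fE.
Qed.

Lemma lift_perm_inj n (i j : 'I_n.+1) : injective (@lift_perm n i j).
Proof.
move=> u v uv; apply/permP => k; apply: (@lift_inj _ j).
by rewrite -!(lift_perm_lift i) uv.
Qed.

Lemma sum_lift_perm (V : nmodType) n (i j : 'I_n.+1) (P : pred 'S_n.+1)
    (F : 'S_n.+1 -> V) :
  \sum_(s | P s && (s i == j)) F s =
  \sum_(u | P (lift_perm i j u)) F (lift_perm i j u).
Proof.
rewrite (reindex_onto (lift_perm i j)
  (fun s => odflt 1%g [pick u | s == lift_perm i j u])) /=.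
  apply: eq_bigl => u; rewrite lift_perm_id eqxx andbT.
  case: pickP => [v /eqP/lift_perm_inj <-|/(_ u)]; last by rewrite eqxx.
  by rewrite eqxx andbT.
move=> s /andP[_ /eqP/lift_perm_surj[u ->]].
by case: pickP => [v /eqP //|/(_ u)]; rewrite eqxx.
Qed.

Lemma av321P n (s : 'S_n) :
  reflect (forall i j k : 'I_n, (i < j)%N -> (j < k)%N ->
             (s j < s i)%N -> (s k < s j)%N -> False) (av321 s).
Proof.
apply: (iffP negP) => [nE i j k ij jk ji kj|nE].
  apply: nE; apply/existsP; exists i; apply/existsP; exists j.
  by apply/existsP; exists k; apply/and4P.
by case/existsP=> i /existsP[j /existsP[k /and4P[]]]; apply: nE.
Qed.

Lemma ltn_bump2 h i j : (bump h i < bump h j)%N = (i < j)%N.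
Proof. by rewrite ltnNge leq_bump2 -ltnNge. Qed.

Lemma sum_ltn_ord n h : (h <= n)%N -> (\sum_(i < n) (i < h) = h)%N.
Proof.
move=> hn; transitivity (minn n h); last by lia.
elim: n {hn} => [|n IHn]; first by rewrite big_ord0 min0n.
rewrite big_ord_recr /= IHn; lia.
Qed.

(** * Statistics under the insertion of an entry *)

Lemma invE n (s : 'S_n) :
  Defs.inv s = (\sum_(i < n) \sum_(j < n) ((i < j)%N && (s j < s i)%N))%N.
Proof.
rewrite /Defs.inv -sum1_card pair_big /= [LHS]big_mkcond /=.
by apply: eq_bigr => p _; rewrite inE; case: ifP.
Qed.

(** The new entry is inverted with the smaller values on its right and the larger ones on its left;
    all other inversions are kept. *)
Lemma inv_lift_perm n (i j : 'I_n.+1) (s : 'S_n) :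
  (Defs.inv (lift_perm i j s) =
    \sum_(k < n) (i <= k) * (s k < j) +
    \sum_(k < n) (k < i) * (j <= s k) + Defs.inv s)%N.
Proof.
rewrite !invE (bigD1_ord i) //= (bigD1_ord i) //= ltnn add0n -addnA.
congr (_ + _)%N.
  apply: eq_bigr => k _; rewrite lift_perm_id lift_perm_lift /= mulnb.
  by rewrite /bump; lia.
rewrite -big_split /=; apply: eq_bigr => k _.
rewrite (bigD1_ord i) //=; congr (_ + _)%N.
  rewrite lift_perm_id lift_perm_lift /= mulnb /bump; lia.
by apply: eq_bigr => l _; rewrite !lift_perm_lift /= !ltn_bump2.
Qed.

Lemma inv_lift_perm0l n (h : 'I_n.+1) (s : 'S_n) :
  Defs.inv (lift_perm ord0 h s) = (h + Defs.inv s)%N.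
Proof.
rewrite inv_lift_perm [X in (_ + X + _)%N]big1 ?addn0 //; congr (_ + _)%N.
rewrite -[RHS](@sum_ltn_ord n) -1?ltnS //.
rewrite [RHS](reindex_inj (@perm_inj _ s)) /=.
by apply: eq_bigr => k _; rewrite mul1n.
Qed.

Lemma inv_lift_perm0r n (h : 'I_n.+1) (s : 'S_n) :
  Defs.inv (lift_perm h ord0 s) = (h + Defs.inv s)%N.
Proof.
rewrite inv_lift_perm big1 ?add0n => [|k _]; last by rewrite muln0.
congr (_ + _)%N; rewrite -[RHS](@sum_ltn_ord n) -1?ltnS //.
by apply: eq_bigr => k _; rewrite muln1.
Qed.

Lemma lrmE n (s : 'S_n) :
  lrm s = (\sum_(i < n) [forall j : 'I_n, (j <= i)%N ==> (s j <= s i)%N])%N.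
Proof.
rewrite /lrm -sum1_card [LHS]big_mkcond /=.
apply: eq_bigr => i _; rewrite inE eqn_leq.
rewrite (@leq_bigmax_cond _ (fun j : 'I_n => (j <= i)%N) (fun j => s j) i) //=.
have -> : (\max_(j < n | (j <= i)%N) s j <= s i)%N =
  [forall j : 'I_n, (j <= i)%N ==> (s j <= s i)%N].
  apply/bigmax_leqP/forallP => H j; last exact: (implyP (H j)).
  by apply/implyP; apply: H.
by case: [forall _, _].
Qed.

Lemma forall_ord_lift n (i : 'I_n.+1) (P : pred 'I_n.+1) :
  [forall k, P k] = P i && [forall k, P (lift i k)].
Proof.
apply/forallP/andP => [H|[Pi /forallP H] k]; first by split=> //; apply/forallP.
by case: (unliftP i k) => [k'|] ->.
Qed.

(** Being the minimum and not first, the new entry 0 is no record and hinders none. *)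
Lemma lrm_lift_perm0r n (h : 'I_n.+1) (s : 'S_n) : (0 < h)%N ->
  lrm (lift_perm h ord0 s) = lrm s.
Proof.
move=> h0; rewrite !lrmE (bigD1_ord h) //= -[RHS]add0n; congr (_ + _)%N.
  apply/eqP; rewrite eqb0; apply/forallPn; exists ord0; rewrite leq0n /=.
  apply: contraL h0; rewrite lift_perm_id leqn0 -[X in _ == X]/(val (@ord0 n)).
  rewrite val_eqE -[X in _ == X](lift_perm_id h ord0 s) (inj_eq perm_inj).
  by move/eqP <-.
apply: eq_bigr => k _; rewrite (forall_ord_lift h) lift_perm_id leq0n.
rewrite implybT /=.
congr (nat_of_bool _); apply: eq_forallb => l.
by rewrite !lift_perm_lift /= !leq_bump2.
Qed.

(** The new first entry h is a record. It destroys none: the first h entries of [s] are at least h,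
    and when h > 0 any later record is at least s(0) >= h. *)
Lemma lrm_lift_perm0l n (h : 'I_n.+1) (s : 'S_n) :
  (forall i : 'I_n, (i < h)%N -> (h <= s i)%N) ->
  lrm (lift_perm ord0 h s) = (lrm s).+1.
Proof.
move=> sh; rewrite !lrmE (bigD1_ord ord0) //= -[RHS]add1n; congr (_ + _)%N.
  rewrite (introT forallP) // => k; apply/implyP; rewrite leqn0 => /eqP k0.
  by rewrite (_ : k = ord0) //; apply: val_inj.
apply: eq_bigr => k _; rewrite (forall_ord_lift ord0) lift_perm_id.
rewrite lift_perm_lift /=.
under eq_forallb => l do rewrite !lift_perm_lift /= !leq_bump2.
congr (nat_of_bool _); case: forallP => [H|]; rewrite ?andbF ?andbT //.
suff : (h <= s k)%N by rewrite /bump; lia.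
have [kh|hk] := ltnP k h; first exact: sh.
case: (posnP h) => [->//|h0].
have n0 : (0 < n)%N by have := ltn_ord h; lia.
by apply: leq_trans (sh (Ordinal n0) h0) (implyP (H (Ordinal n0)) _).
Qed.

Definition fixge n (h : nat) (s : 'S_n) : nat :=
  (\sum_(i < n) ((h <= i)%N && (s i == i)))%N.

Lemma fixge0 n (s : 'S_n) : fixge 0 s = fix_ s.
Proof.
rewrite /fixge /fix_ -sum1_card [RHS]big_mkcond /=.
by apply: eq_bigr => i _; rewrite inE; case: eqP.
Qed.

Lemma fixge_ord n (h : 'I_n) (s : 'S_n) :
  fixge h s = ((s h == h) + fixge h.+1 s)%N.
Proof.
rewrite /fixge (bigD1 h) //= leqnn /=; congr (_ + _)%N.
rewrite [RHS](bigD1 h) //= ltnn add0n; apply: eq_bigr => i ih.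
by rewrite [in RHS]ltn_neqAle (_ : (h : nat) != i) // eq_sym.
Qed.

(** Positions and values from h on are both shifted by one, while a value below h stays put and
    cannot meet a position above h. *)
Lemma fixge_lift_perm0l n (h : 'I_n.+1) (s : 'S_n) :
  fixge h.+1 (lift_perm ord0 h s) = fixge h s.
Proof.
rewrite /fixge (bigD1_ord ord0) //=; apply: eq_bigr => k _.
rewrite lift_perm_lift -!val_eqE /= /bump; lia.
Qed.

Lemma fixge_lift_perm0r n (h : 'I_n.+1) (s : 'S_n) :
  fixge h.+1 (lift_perm h ord0 s) = fixge h s.
Proof.
rewrite /fixge (bigD1_ord h) //= ltnn; apply: eq_bigr => k _.
rewrite lift_perm_lift -!val_eqE /= /bump; lia.
Qed.

(* [unliftP] gives [k' : 'I_n.+1.-1], which lia does not identify with ['I_n]. *)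
Lemma lift_or_eq n (h k : 'I_n.+1) : (exists k' : 'I_n, k = lift h k') \/ k = h.
Proof. by case: (unliftP h k) => [k'|] ->; [left; exists k' | right]. Qed.

(** * 321-avoidance under the insertion of an entry *)

Lemma av321_lift_perm n (i j : 'I_n.+1) (u : 'S_n) :
  av321 (lift_perm i j u) -> av321 u.
Proof.
move=> /av321P av; apply/av321P => a b c ab bc ba cb.
by apply: (av (lift i a) (lift i b) (lift i c));
  rewrite ?lift_perm_lift /= ltn_bump2.
Qed.

(** If the new first entry h began a 321 pattern, the middle value would be below h, hence not among
    the first h positions, and u(0) >= h could begin the pattern instead. *)
Lemma av321_lift_perm0l n (h : 'I_n.+1) (u : 'S_n) :
  (forall i : 'I_n, (i < h)%N -> (h <= u i)%N) ->
  av321 u -> av321 (lift_perm ord0 h u).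
Proof.
move=> uh /av321P av; apply/av321P => a b c.
case: (lift_or_eq ord0 b) => [[b' ->]|->]; last by rewrite ltn0.
case: (lift_or_eq ord0 c) => [[c' ->]|->]; last by rewrite ltn0.
case: (lift_or_eq ord0 a) => [[a' ->]|->];
  rewrite ?lift_perm_id !lift_perm_lift /=.
  by rewrite !ltn_bump2; apply: av.
rewrite !ltn_bump2 => _ bc bh cb.
have {}bh : (u b' < h)%N by move: bh; rewrite /bump; lia.
have b0 : (0 < b')%N by have := uh b'; lia.
have n0 : (0 < n)%N by have := ltn_ord b'; lia.
apply: (av (Ordinal n0) b' c') => //; apply: (leq_trans bh (uh _ _)) => /=.
exact: leq_trans bh.
Qed.

(** The new 0 can only end a 321 pattern, which would need a descent among the first h positions. *)
Lemma av321_lift_perm0r n (h : 'I_n.+1) (u : 'S_n) :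
  (forall i j : 'I_n, (i < j)%N -> (j < h)%N -> (u i < u j)%N) ->
  av321 u -> av321 (lift_perm h ord0 u).
Proof.
move=> uh /av321P av; apply/av321P => a b c.
case: (lift_or_eq h a) => [[a' ->]|->]; last by rewrite lift_perm_id ltn0.
case: (lift_or_eq h b) => [[b' ->]|->]; last by rewrite lift_perm_id ltn0.
case: (lift_or_eq h c) => [[c' ->]|->];
  rewrite ?lift_perm_id !lift_perm_lift /=.
  by rewrite !ltn_bump2; apply: av.
rewrite !ltn_bump2 => ab bh ba _.
by have := uh a' b' ab; move: bh; rewrite /bump; lia.
Qed.

(** * Open permutations under up, level and down steps *)

(* The first [h] positions and the values below [h] stand for the rows and
   columns left empty by what has been read. *)
Definition open_av321 n (h : nat) (s : 'S_n) : bool :=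
  av321 s && [forall i : 'I_n, (i < h)%N ==> (h <= s i)%N].

Lemma open_av321P n h (s : 'S_n) :
  reflect (av321 s /\ forall i : 'I_n, (i < h)%N -> (h <= s i)%N)
          (open_av321 h s).
Proof.
apply: (iffP andP) => -[av H]; split=> //.
  by move=> i ih; have /forallP/(_ i)/implyP := H; apply.
by apply/forallP => i; apply/implyP/H.
Qed.

(** The value 0 lies at or beyond position h, so a descent in the first h positions would extend to
    a 321 pattern. *)
Lemma open_av321_lt n (h : nat) (s : 'S_n) (i j : 'I_n) :
  open_av321 h s -> (i < j)%N -> (j < h)%N -> (s i < s j)%N.
Proof.
move=> /open_av321P[/av321P av sh] ij jh.
have n0 : (0 < n)%N by have := ltn_ord i; lia.
pose p := (s^-1)%g (Ordinal n0).
have sp : s p = 0%N :> nat by rewrite permKV.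
have hp : (h <= p)%N by rewrite leqNgt; apply/negP => /sh; lia.
have sjh := sh j jh.
rewrite ltn_neqAle leqNgt; apply/andP; split.
  by apply: contraTneq ij => /val_inj/perm_inj ->; rewrite ltnn.
apply/negP => ji; apply: (av i j p) => //; lia.
Qed.

(** As s(h) is not 0, the value 0 lies beyond position h, and s(k) < s(0) would again give a 321
    pattern. *)
Lemma open_av321_ltS n (h : 'I_n.+1) (s : 'S_n.+1) (k : 'I_n.+1) :
  open_av321 h s -> s h != ord0 -> (0 < k)%N -> (k <= h)%N ->
  (s ord0 < s k)%N.
Proof.
move=> /open_av321P[/av321P av sh] sh0 k0 kh.
pose p := (s^-1)%g ord0.
have sp : s p = ord0 by rewrite permKV.
have hp : (h <= p)%N by rewrite leqNgt; apply/negP => /sh; rewrite sp /=; lia.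
have hp' : (h : nat) != p by apply: contra sh0 => /eqP/val_inj ->; rewrite sp.
have kp : (k < p)%N by lia.
rewrite ltn_neqAle leqNgt; apply/andP; split.
  by apply: contraTneq k0 => /val_inj/perm_inj <-.
apply/negP => ji; apply: (av ord0 k p) => //; rewrite sp lt0n.
have sp0 : s p = 0%N :> nat by rewrite sp.
by apply: contraTneq kp; rewrite -sp0 => /val_inj/perm_inj ->; rewrite ltnn.
Qed.

(** The up step. The first h entries increase, so among them only s(0) can equal h; once it exceeds
    h, [open_av321_ltS] bounds the entries up to position h. *)
Lemma open_av321S n (h : 'I_n.+1) (s : 'S_n.+1) :
  open_av321 h.+1 s =
  [&& open_av321 h s, s ord0 != h & s h != ord0].
Proof.
apply/idP/and3P => [/open_av321P[av sh]|[os s0h sh0]].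
  have s0 := sh ord0 isT; have shh := sh h (leqnn _); split.
  - apply/open_av321P; split=> // i ih; apply: ltnW; apply: sh; exact: ltnW.
  - by apply: contraTneq s0 => ->; rewrite ltnn.
  - by apply: contraTneq shh => ->.
have [av sh] := elimT (open_av321P _ _) os.
apply/open_av321P; split=> // i ih.
have s0 : (h < s ord0)%N.
  rewrite ltn_neqAle eq_sym s0h /=; case: (posnP h) => [->//|h0].
  exact: sh.
case: (posnP i) => [i0|i0]; first by rewrite (_ : i = ord0) //; apply: val_inj.
by apply: ltn_trans s0 (open_av321_ltS os sh0 i0 _).
Qed.

Lemma open_av321_lift_perm00 n (u : 'S_n) :
  open_av321 0 (lift_perm ord0 ord0 u) = open_av321 0 u.
Proof.
apply/open_av321P/open_av321P => -[av _]; split=> //.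
  exact: av321_lift_perm av.
exact: av321_lift_perm0l.
Qed.

(** A level step. Deleting s(0) = h moves position h into the first h ones; [open_av321_ltS] puts
    its value above h. *)
Lemma open_av321_lift_perm0l n (h : 'I_n.+1) (u : 'S_n) : (0 < h)%N ->
  open_av321 h (lift_perm ord0 h u) && (lift_perm ord0 h u h != ord0) =
  open_av321 h u.
Proof.
move=> h0; apply/andP/idP => [[os sh0]|/open_av321P[av uh]].
  have [av sh] := elimT (open_av321P _ _) os.
  apply/open_av321P; split=> [|i ih]; first exact: av321_lift_perm av.
  have := open_av321_ltS os sh0 (k := lift ord0 i) isT ih.
  by rewrite lift_perm_id lift_perm_lift /= /bump; lia.
have sh (i : 'I_n.+1) : (i <= h)%N -> (h <= lift_perm ord0 h u i)%N.
  case: (lift_or_eq ord0 i) => [[k ->]|->];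
    rewrite ?lift_perm_id // lift_perm_lift /=.
  by move=> /uh; rewrite /bump; lia.
split.
  apply/open_av321P; split=> [|i ih]; first exact: av321_lift_perm0l.
  by apply: sh; apply: ltnW.
by apply: contraTneq (sh h (leqnn _)) => ->; rewrite leqn0 -lt0n.
Qed.

Lemma lift_perm0r_ord0 n (h : 'I_n.+2) (u : 'S_n.+1) : (0 < h)%N ->
  lift_perm h ord0 u ord0 = lift ord0 (u ord0).
Proof.
move=> h0; rewrite -(lift_perm_lift h); congr (lift_perm _ _ _ _).
by apply: val_inj; rewrite /= /bump leqNgt h0.
Qed.

Lemma open_av321_lift_perm0r n (h : 'I_n.+2) (u : 'S_n.+1) : (0 < h)%N ->
  open_av321 h (lift_perm h ord0 u) && (lift_perm h ord0 u ord0 != h) =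
  open_av321 h u.
Proof.
move=> h0; apply/andP/idP => [[os s0h]|ou].
  have [/av321P av sh] := elimT (open_av321P _ _) os.
  apply/open_av321P; split=> [|i ih].
    by apply: av321_lift_perm (elimT (open_av321P _ _) os).1.
  have lh : lift h i = i :> nat by rewrite /= /bump; lia.
  have := sh (lift h i); rewrite lh => /(_ ih) hs.
  (* Otherwise s(0) > h = s(i) > 0 = s(h) would be a 321 pattern. *)
  have : (lift_perm h ord0 u (lift h i) : nat) != h.
    apply/eqP => E.
    have i0 : (0 < i)%N.
      rewrite lt0n; apply: contra s0h => /eqP i0; apply/eqP/val_inj.
      apply: etrans E; congr (val (lift_perm _ _ _ _)); apply: val_inj.
      exact: etrans (esym i0) (esym lh).
    have s0 : (h < lift_perm h ord0 u ord0)%N.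
      by rewrite ltn_neqAle eq_sym s0h sh.
    by apply: (av ord0 (lift h i) h); rewrite ?lift_perm_id ?lh ?E.
  by move: hs; rewrite lift_perm_lift /= /bump; lia.
have [av uh] := elimT (open_av321P _ _) ou; split.
  apply/open_av321P; split=> [|i ih].
    by apply: av321_lift_perm0r av => i j; apply: open_av321_lt.
  case: (lift_or_eq h i) ih => [[k ->]|->]; last by rewrite ltnn.
  rewrite lift_perm_lift /= => kh.
  by have := uh k; move: kh; rewrite /bump; lia.
rewrite lift_perm0r_ord0 // -val_eqE /=; have := uh ord0 h0; rewrite /bump; lia.
Qed.

(** The down step deletes two entries at once: [lift_perm ord0 h v] sends 0 to h, so it is not open
    at level h+1 and the two level steps do not compose. *)
Lemma open_av321_lift_perm_lift_perm n (h : 'I_n.+1) (v : 'S_n) :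
  open_av321 h.+1 (lift_perm (lift ord0 h) ord0 (lift_perm ord0 h v)) =
  open_av321 h v.
Proof.
set u := lift_perm ord0 h v; set H := lift ord0 h.
have lH (i : 'I_n.+1) : (i < h.+1)%N -> lift H i = i :> nat.
  by rewrite /= /bump; lia.
apply/idP/idP => [/open_av321P[av sh]|ov].
  apply/open_av321P; split=> [|i ih].
    exact: av321_lift_perm (av321_lift_perm av).
  have lt_ih : (lift ord0 i < h.+1)%N by [].
  have := sh (lift H (lift ord0 i)); rewrite lH // => /(_ lt_ih).
  by rewrite !lift_perm_lift /= /bump; lia.
have [av vh] := elimT (open_av321P _ _) ov; apply/open_av321P; split=> [|i].
  apply: av321_lift_perm0r (av321_lift_perm0l vh av) => i j.
  case: (lift_or_eq ord0 j) => [[j' ->]|->]; last by rewrite ltn0.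
  case: (lift_or_eq ord0 i) => [[i' ->]|->];
    rewrite ?lift_perm_id !lift_perm_lift /=.
    by rewrite !ltn_bump2; apply: open_av321_lt.
  by move=> _ /vh; rewrite /bump; lia.
case: (lift_or_eq H i) => [[k ->]|->]; last by rewrite ltnn.
rewrite lift_perm_lift /= => kh; rewrite /bump leq0n ltnS /u.
case: (lift_or_eq ord0 k) kh => [[k' ->]|->];
  rewrite ?lift_perm_id // lift_perm_lift /=.
by move=> kh; have := vh k'; move: kh; rewrite /bump; lia.
Qed.

(** * Recurrences for the generating functions *)

Section Weights.
Variables (R : comNzRingType) (q t x : R).

(* If [open_av321 h s], then [fixge h s] counts all the fixed points of [s]; unlike
   [fix_], it is preserved by the deletion of an entry. *)
Definition open_sum (n h : nat) : R :=
  \sum_(s : 'S_n | open_av321 h s)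
     q ^+ Defs.inv s * t ^+ lrm s * x ^+ fixge h s.

Lemma open_sum00 : open_sum 0 0 = 1.
Proof.
rewrite /open_sum (big_pred1 (1%g : 'S_0)) => [|s]; last first.
  rewrite [RHS](_ : _ = true); last by apply/eqP/permP; case.
  by apply/open_av321P; split=> [|[]//]; apply/av321P; case.
rewrite invE lrmE /fixge !big1 ?mulr1 ?expr0 //; try by case.
Qed.

Lemma open_sumSS h : open_sum h.+1 h.+1 = 0.
Proof.
rewrite /open_sum big_pred0 // => s.
apply/negP => /open_av321P[_ /(_ ord0 isT)].
by rewrite leqNgt ltn_ord.
Qed.

Lemma open_sum0 n : open_sum n.+1 0 = open_sum n.+1 1 + t * x * open_sum n 0.
Proof.
rewrite /open_sum (bigID (fun s : 'S_n.+1 => s ord0 == ord0)) /= addrC.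
congr (_ + _).
  apply: eq_big => [s|s /andP[_ s0]].
    by rewrite (open_av321S ord0) andbb.
  by rewrite (fixge_ord ord0) (negPf s0).
rewrite sum_lift_perm big_distrr /=; apply: eq_big => [s|s _].
  exact: open_av321_lift_perm00.
rewrite inv_lift_perm0l lrm_lift_perm0l // (fixge_ord ord0) lift_perm_id eqxx.
rewrite (fixge_lift_perm0l ord0) /= !add0n !exprS; ring.
Qed.

(** Inserting h in front contributes t q^h, then 0 at position h+1 contributes q^(h+1): hence the
    exponent 2h+1 of the down step. *)
Lemma open_sumS n (h : 'I_n.+1) :
  open_sum n.+2 h.+1 = open_sum n.+2 h.+2
    + (1 + t) * q ^+ h.+1 * open_sum n.+1 h.+1
    + t * q ^+ (2 * h).+1 * open_sum n h.
Proof.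
pose H := lift ord0 h; pose B (s : 'S_n.+2) := open_av321 H s.
pose w m k (s : 'S_m) : R := q ^+ Defs.inv s * t ^+ lrm s * x ^+ fixge k s.
(* Position H is fixed in none of the four cases below, so the threshold of [fixge] can be raised to
   H+1. *)
have wE (s : 'S_n.+2) : s H != H -> w _ H s = w _ H.+1 s.
  by move=> sH; rewrite /w fixge_ord (negPf sH).
have wl m (k : 'I_m.+1) u : open_av321 k u ->
    w _ k.+1 (lift_perm ord0 k u) = t * q ^+ k * w _ k u.
  move=> ou; rewrite /w inv_lift_perm0l lrm_lift_perm0l ?fixge_lift_perm0l.
    rewrite exprD exprS; ring.
  by case/open_av321P: ou.
have wr (u : 'S_n.+1) k :
    k = H :> nat -> w _ k.+1 (lift_perm H ord0 u) = q ^+ H * w _ H u.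
  move=> ->; rewrite /w inv_lift_perm0r lrm_lift_perm0r // fixge_lift_perm0r.
  rewrite exprD; ring.
have sum_up : \sum_(s | B s && (s ord0 != H) && (s H != ord0)) w _ H s =
    open_sum n.+2 h.+2.
  apply: eq_big => [s|s /andP[/andP[Bs s0] sH]].
    by rewrite (open_av321S H) andbA.
  (* A fixed H would give H <= s(0) < s(H) = H. *)
  rewrite wE //; apply/negP => /eqP sHH.
  have := open_av321_ltS (k := H) Bs sH isT (leqnn _); rewrite sHH.
  by have /open_av321P[_ /(_ ord0 isT)] := Bs; lia.
have sum_l : \sum_(s | B s && (s H != ord0) && (s ord0 == H)) w _ H s =
    t * q ^+ H * open_sum n.+1 H.
  rewrite sum_lift_perm /open_sum big_distrr /=.
  apply: eq_big => [u|u]; rewrite /B open_av321_lift_perm0l //.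
  move=> ou; rewrite wE ?wl //.
  apply: contraTneq (isT : (0 < H)%N) => E.
  by rewrite (perm_inj (etrans E (esym (lift_perm_id _ _ _)))).
have sum_r : \sum_(s | B s && (s ord0 != H) && (s H == ord0)) w _ H s =
    q ^+ H * open_sum n.+1 H.
  rewrite sum_lift_perm /open_sum big_distrr /=.
  apply: eq_big => [u|u]; rewrite /B open_av321_lift_perm0r //.
  by move=> ou; rewrite wE ?wr // lift_perm_id.
have sum_lr : \sum_(s | B s && (s ord0 == H) && (s H == ord0)) w _ H s =
    t * q ^+ (2 * h).+1 * open_sum n h.
  rewrite sum_lift_perm.
  under eq_bigl => u do rewrite lift_perm0r_ord0 // (inj_eq lift_inj).
  rewrite sum_lift_perm /open_sum big_distrr /=.
  apply: eq_big => [v|v]; rewrite /B open_av321_lift_perm_lift_perm //.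
  move=> ov; rewrite wE ?lift_perm_id // wr // wl //.
  have -> : (2 * h).+1 = (H + h)%N by rewrite addSn addnn mul2n.
  rewrite exprD /w; ring.
rewrite [LHS](bigID (fun s : 'S_n.+2 => s ord0 == H)) /=.
rewrite (bigID (fun s : 'S_n.+2 => s H == ord0)) /= sum_lr.
rewrite [X in _ + X](bigID (fun s : 'S_n.+2 => s H == ord0)) /= sum_r sum_up.
under eq_bigl => s do rewrite andbAC.
rewrite sum_l; ring.
Qed.
End Weights.

(** * Motzkin recurrences and continued fractions *)

Section MotzkinFraction.
Variables (R : comUnitRingType) (b lam : nat -> R).

Lemma fcoef_mulX (f : fps R) n : fcoef (fps_X R * f) n.+1 = fcoef f n.
Proof.
rewrite fcoefM big_ord_recl big_ord_recl /= mul0r add0r mul1r subSS subn0.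
by rewrite big1 ?addr0 // => i _; rewrite mul0r.
Qed.

Lemma fcoef_mulC c (f : fps R) n : fcoef (fps_const c * f) n = c * fcoef f n.
Proof.
rewrite fcoefM big_ord_recl /= subn0 big1 ?addr0 // => i _.
by rewrite mul0r.
Qed.

(** The denominator is cleared, with a factor z in front of each term so that coefficient n+1 is
    read off from coefficients n. *)
Lemma jfrac_fromS N j (J := jfrac_from b lam N.+1 j) :
  J = 1 + fps_X R * (fps_const (b j) * J)
        + fps_X R * (fps_const (lam j.+1)
                     * (fps_X R * jfrac_from b lam N j.+1 * J)).
Proof.
have U := jfrac_den_unit (b j) (lam j.+1) (jfrac_from b lam N j.+1).
have : J * (1 - fps_const (b j) * fps_X R - fps_const (lam j.+1) * fps_X R ^+ 2
   * jfrac_from b lam N j.+1) = 1 by rewrite /J /= mul1r mulVr.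
set D := jfrac_from b lam N j.+1; move: J => J E; rewrite -[in RHS]E; ring.
Qed.

(* With [lam] carried by the down steps and weight 1 on the up steps, this
   enumerates the Motzkin paths of height at most [N] from [h] to 0, cut at
   their first visits to [h-1], ..., 0. *)
Fixpoint descent_series N h : fps R :=
  if h is h'.+1 then
    fps_const (lam h)
      * (fps_X R * jfrac_from b lam (N - h) h * descent_series N h')
  else jfrac_from b lam N 0.

Lemma descent_series0 N (K := descent_series N.+1) :
  K 0%N = 1 + fps_X R * (fps_const (b 0%N) * K 0%N) + fps_X R * K 1%N.
Proof. by rewrite /K /= subSS subn0; exact: jfrac_fromS. Qed.

Lemma descent_seriesS N h (K := descent_series N) : (h.+1 < N)%N ->
  K h.+1 = fps_X R * (fps_const (b h.+1) * K h.+1) + fps_X R * K h.+2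
           + fps_X R * (fps_const (lam h.+1) * K h).
Proof.
move=> hN; rewrite /K /=.
have -> : (N - h.+1)%N = (N - h.+2).+1 by lia.
set J' := jfrac_from b lam (N - h.+2) h.+2.
(* The terms of the equation for J are the first step of a path: 1 gives the down step, [b] the
   level step, [lam] the up step. *)
rewrite {1}jfrac_fromS -/J'; set J := jfrac_from _ _ _ _; ring.
Qed.

(** By induction on n, the coefficients of the descent series obey the recurrences of M while n + h
    < N, where the height bound is not felt. *)
Lemma motzkin_jfraction (M : nat -> nat -> R) :
  M 0%N 0%N = 1 -> (forall h, M 0%N h.+1 = 0) ->
  (forall n, M n.+1 0%N = M n 1%N + b 0%N * M n 0%N) ->
  (forall n h,
     M n.+1 h.+1 = M n h.+2 + b h.+1 * M n h.+1 + lam h.+1 * M n h) ->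
  is_jfraction b lam (Fps (M^~ 0%N)).
Proof.
move=> M00 M0S MS0 MSS.
have KM N n h : (n + h < N)%N -> fcoef (descent_series N h) n = M n h.
  elim: n h => [|n IHn] [|h] hN.
  - case: N hN => // N _.
    by rewrite descent_series0 !fcoefD !fcoefM0 fcoef1 !mul0r !addr0 M00.
  - by rewrite descent_seriesS // !fcoefD !fcoefM0 !mul0r !addr0 M0S.
  - case: N IHn hN => // N IHn hN.
    rewrite descent_series0 !fcoefD !fcoef_mulX fcoef_mulC fcoef1 add0r.
    by rewrite !IHn ?MS0 1?addrC //; lia.
  have KS : (h.+1 < N)%N by lia.
  move: (descent_seriesS KS) IHn; move: (descent_series N) => K -> IHn.
  rewrite !fcoefD !fcoef_mulX !fcoef_mulC !IHn ?MSS; try lia.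
  by rewrite (addrC (b _ * _)).
move=> m; exists m => N mN k km; apply: (KM N k 0%N).
by rewrite addn0; apply: leq_trans mN.
Qed.
End MotzkinFraction.

Unset Implicit Arguments.

Theorem theorem8p3 :
  is_jfraction
    (fun j : nat => if j == 0%N then t_ * x_ else (1 + t_) * q_ ^+ j)
    (fun j : nat => t_ * q_ ^+ (2 * j - 1))
    I_series.
Proof.
(* Here n counts the rows still to be read; with the h empty rows the size is n + h. *)
pose M n h := open_sum q_ t_ x_ (n + h) h.
have -> : I_series = Fps (M^~ 0%N).
  apply/fpsP => n; rewrite /= /M addn0; apply: eq_big => [s|s _].
    rewrite /open_av321 andb_idr // => _.
    by apply/forallP => i; apply/implyP.
  by rewrite fixge0.
apply: motzkin_jfraction => [|h|n|n h]; rewrite /M.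
- exact: open_sum00.
- exact: open_sumSS.
- by rewrite !addn0 addn1; apply: open_sum0.
rewrite !addnS addSn; have lt_h : (h < (n + h).+1)%N by rewrite ltnS leq_addl.
rewrite (open_sumS _ _ _ (Ordinal lt_h)) /=.
by rewrite (_ : (2 * h.+1 - 1)%N = (2 * h).+1) //; lia.
Qed.
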